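(* Let $p$ be an odd prime. The Diophantine equation $$(x^{2}+y^{2})^{2}+(2pxy)^{2}=z^{2}$$ has a solution in positive integers $x,y,z$ with $\gcd(x,y)=1$ if and only if there exists a Heron triangle with area $p$ and having one of its angles $\theta$ satisfying $\tan\frac{\theta}{2}=\frac1p$. Moreover, if $p\equiv 5\pmod 8$ and $p^{2}+1=2q$ for some prime $q$, then the equation $(x^{2}+y^{2})^{2}+(2pxy)^{2}=z^{2}$ has no solution in positive integers $x,y,z$ with $\gcd(x,y)=1$.
   Context: A Heron triangle is a (non-degenerate) triangle whose three side lengths are rational numbers and whose area is rational. *)

(* Defs.v *)
From HB Require Import structures.
From mathcomp Require Import all_boot all_order all_algebra.
From mathcomp Require Import reals trigo.

Set Implicit Arguments.
Unset Strict Implicit.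
Unset Printing Implicit Defensive.

Import Order.TTheory GRing.Theory Num.Theory.
Local Open Scope ring_scope.

Definition dotp (R : realType) (u v : 'rV[R]_2) : R := \sum_(i < 2) u 0 i * v 0 i.

(* The norm `|u| on 'rV[R]_2 in MathComp-Analysis is the sup norm, hence this
   separate Euclidean norm. *)
Definition eucl_norm (R : realType) (u : 'rV[R]_2) : R := Num.sqrt (dotp u u).

Definition eucl_dist (R : realType) (A B : 'rV[R]_2) : R := eucl_norm (B - A).

Definition edges (R : realType) (A B C : 'rV[R]_2) : 'M[R]_2 :=
  col_mx (B - A) (C - A).

Definition nondegenerate (R : realType) (A B C : 'rV[R]_2) : bool :=
  row_free (edges A B C).

Definition triangle_area (R : realType) (A B C : 'rV[R]_2) : R :=
  `|\det (edges A B C)| / 2.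

(* The angle at the middle argument B. It is meaningful only if A != B and
   C != B, which nondegeneracy ensures. *)
Definition angle (R : realType) (A B C : 'rV[R]_2) : R :=
  acos (dotp (A - B) (C - B) / (eucl_norm (A - B) * eucl_norm (C - B))).

Definition is_angle_of (R : realType) (A B C : 'rV[R]_2) (theta : R) : Prop :=
  [\/ theta = angle C A B, theta = angle A B C | theta = angle B C A].

Definition heron_triangle (R : realType) (A B C : 'rV[R]_2) : Prop :=
  [/\ nondegenerate A B C,
      rational (eucl_dist A B), rational (eucl_dist B C), rational (eucl_dist C A)
    & rational (triangle_area A B C)].

Definition has_coprime_solution (p : nat) : Prop :=
  (exists x y z : nat, [/\ 0 < x, 0 < y, 0 < z, coprime x y &
    (x ^ 2 + y ^ 2) ^ 2 + (2 * p * x * y) ^ 2 = z ^ 2])%N.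

(* Main.v *)
Require Import Defs.
From HB Require Import structures.
From mathcomp Require Import all_boot all_order all_algebra.
From mathcomp Require Import finfield reals trigo.
From mathcomp Require Import zify ring lra.

(** The equivalence is elementary trigonometry.  If the angle opposite to the
    side [c] has half-angle tangent [1/p], then its sine is [2p/(p^2+1)] and
    its cosine is [(p^2-1)/(p^2+1)].  With [a], [b] the adjacent sides, having
    area [p] means [ab = p^2+1], and then the law of cosines reads
    [c^2 = (a-b)^2 + 4] ([triangle_sides]).  The last equation factors as
    [(c+(a-b))/2 * (c-(a-b))/2 = 1], so [c = s + 1/s] and [a-b = s - 1/s] for
    some rational [s = x/y] in lowest terms; since [(a+b)^2 = c^2 + 4p^2], the
    number [z = (a+b)xy] satisfies [(x^2+y^2)^2 + (2pxy)^2 = z^2]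
    ([solution_of_rat]).  Reading this backwards gives the sides, hence the
    triangle, from [x, y, z] ([triangle_of_solution]).

    The insolvability is an infinite descent on [xy].  Parity forces [x^2+y^2]
    to be odd, so the equation is, after removing a possible factor [p], a
    primitive Pythagorean triple, and [p xy = m n] with [x^2+y^2 = m^2-n^2]
    (or [xy = m n] with [x^2+y^2 = p(m^2-n^2)] if [p] divides [x^2+y^2]).
    Two factorisations of one number have a common refinement
    ([four_numbers]): [x = ab], [y = cd] and, up to the factor [p], [m = ac],
    [n = bd].  Substituting gives a relation
    [a^2 U = a^2 V + d^2 Q] with [a], [d] coprime, hence
    [Q = k a^2] and [U = V + k d^2] for a single integer [k], and elimination
    shows that [k] divides [p^2+1 = 2q], so that [k] is [1], [2], [q] or [2q].

    - If [p] divides [x^2+y^2], the residues modulo 8 exclude every [k]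
      ([no_solution_p_dvd_norm]).
    - If [k] is [2] or [q], reduction modulo [p] would make [2] or [-2] a
      square in the field with [p] elements, which [p = 5 mod 8] forbids
      ([Fp_sqr_twice]).
    - If [k] is [1], the two relations are two Pythagorean triples linked by
      [b], and the parameters of one of them are a smaller solution
      ([smaller_solution_hypotenuse], [smaller_solution_leg]).
    - If [k = 2q = p^2+1], solving for the squares gives the same pair of
      relations with [(a, b)] and [(c, d)] exchanged. *)

Set Implicit Arguments.
Unset Strict Implicit.
Unset Printing Implicit Defensive.

Import Order.TTheory GRing.Theory Num.Theory.
Local Open Scope ring_scope.
Local Open Scope nat_scope.

(** * Parity, factorisations and Pythagorean triples *)

Lemma odd_double_succ n : odd n -> exists a, n = 2 * a + 1.
Proof. by move=> on; exists n./2; lia. Qed.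

Lemma even_double n : ~~ odd n -> exists a, n = 2 * a.
Proof. by move=> en; exists n./2; lia. Qed.

Lemma sqr_of_odd n : odd n -> exists a, n ^ 2 = 8 * a + 1.
Proof.
case/odd_double_succ=> a ->.
have [b [->|->]] : exists b, a = 2 * b \/ a = 2 * b + 1 by exists a./2; lia.
- by exists (2 * b ^ 2 + b); nia.
- by exists (2 * b ^ 2 + 3 * b + 1); nia.
Qed.

Lemma gcdn_cofactors u w : 0 < u ->
  exists a b, [/\ u = gcdn u w * a, w = gcdn u w * b & coprime a b].
Proof.
move=> u_gt0; set g := gcdn u w.
have g_gt0 : 0 < g by rewrite gcdn_gt0 u_gt0.
have ua : u = g * (u %/ g) by rewrite mulnC divnK ?dvdn_gcdl.
have wb : w = g * (w %/ g) by rewrite mulnC divnK ?dvdn_gcdr.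
exists (u %/ g), (w %/ g); split=> //.
by rewrite /coprime -(eqn_pmul2l g_gt0) muln_gcdr -ua -wb muln1.
Qed.

(** The root is named because [pythagorean_triple] extracts the roots of both
    factors and needs the parity and coprimality of the pair. *)
Lemma sqr_coprime_factor u v w : coprime u v -> u * v = w ^ 2 ->
  u = gcdn u w ^ 2.
Proof.
move=> cuv uvw; set d := gcdn u w.
have [u0|u_gt0] := posnP u.
  rewrite /d u0 gcd0n; move: uvw; rewrite u0 mul0n => <- //.
have d_gt0 : 0 < d by rewrite gcdn_gt0 u_gt0.
have [a [b [ua wb cab]]] := gcdn_cofactors w u_gt0; rewrite -/d in ua wb.
have avdb : a * v = d * b ^ 2.
  by apply/eqP; rewrite -(eqn_pmul2l d_gt0) mulnA -ua uvw wb; apply/eqP; ring.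
have ad : a %| d.
  have : a %| d * b ^ 2 by rewrite -avdb dvdn_mulr.
  by rewrite Gauss_dvdl // coprimeXr.
have da : d %| a.
  have : d %| a * v by rewrite avdb dvdn_mulr.
  rewrite Gauss_dvdl //; apply: coprime_dvdl cuv; exact: dvdn_gcdl.
by rewrite expnS expn1 {1}ua; congr (_ * _); apply/eqP; rewrite eqn_dvd ad da.
Qed.

(** Since [a] is odd, [(c + a)/2] and [(c - a)/2] are coprime with product
    [(b/2)^2], so each is a square. *)
Lemma pythagorean_triple a b c : odd a -> coprime a b -> a ^ 2 + b ^ 2 = c ^ 2 ->
  exists m n, [/\ coprime m n, odd (m + n), a + n ^ 2 = m ^ 2,
                  b = 2 * m * n & c = m ^ 2 + n ^ 2].
Proof.
move=> oa cab abc.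
have eb : ~~ odd b.
  apply/negP=> ob; have [s hs] := sqr_of_odd oa; have [t ht] := sqr_of_odd ob.
  have [oc|/even_double [d hd]] := boolP (odd c).
    by have [r hr] := sqr_of_odd oc; lia.
  by move: abc; rewrite hs ht hd; nia.
have oc : odd c.
  by have := congr1 odd abc; rewrite oddD !oddX /= oa (negbTE eb).
have lac : a <= c by rewrite -(@leq_exp2r _ _ 2) //; lia.
have [b' hb] := even_double eb.
have [u hu] : exists u, c = a + 2 * u by exists ((c - a)./2); lia.
have uv : (u + a) * u = b' ^ 2 by subst; nia.
have cuv : coprime (u + a) u.
  rewrite coprime_sym /coprime gcdnDl -/(coprime u a) coprime_sym.
  apply: (@coprime_dvdr _ (b ^ 2)); last exact: coprimeXr.
  by rewrite hb expnMn -uv !dvdn_mull.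
have e1 := sqr_coprime_factor cuv uv.
have e2 : u = gcdn u b' ^ 2.
  by apply: (@sqr_coprime_factor _ (u + a)); [rewrite coprime_sym | rewrite mulnC].
set m := gcdn (u + a) b' in e1; set n := gcdn u b' in e2.
have bmn : b' = m * n.
  by apply/eqP; rewrite -(@eqn_exp2r _ _ 2) // expnMn -e1 -e2 uv.
exists m, n; split.
- by rewrite -(@coprime_pexpl 2) // -(@coprime_pexpr 2) // -e1 -e2.
- have := congr1 odd e1; have := congr1 odd e2; rewrite !oddX !oddD oa.
  by case: (odd u); case: (odd m); case: (odd n).
- by rewrite -e1 -e2 addnC.
- by rewrite hb bmn mulnA.
- by rewrite -e1 -e2 hu; lia.
Qed.

(** Taking [a] as the gcd of [x] and [m] leaves coprime cofactors [b] and [c]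
    with [b y = c n], so [c] divides [y]. *)
Lemma four_numbers x y m n : 0 < x -> 0 < m -> x * y = m * n ->
  exists a b c d, [/\ x = a * b, y = c * d, m = a * c & n = b * d].
Proof.
move=> x_gt0 m_gt0 xymn; set a := gcdn x m.
have a_gt0 : 0 < a by rewrite gcdn_gt0 x_gt0.
have [b [c [xb mc cbc]]] := gcdn_cofactors m x_gt0; rewrite -/a in xb mc.
have byc : b * y = c * n.
  by apply/eqP; rewrite -(eqn_pmul2l a_gt0) !mulnA -xb -mc xymn.
have : c %| b * y by rewrite byc dvdn_mulr.
rewrite Gauss_dvdr 1?coprime_sym // => /dvdnP [d yd].
have c_gt0 : 0 < c by move: m_gt0; rewrite mc muln_gt0 => /andP [].
exists a, b, c, d; split=> //; first by rewrite mulnC.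
by apply/eqP; rewrite -(eqn_pmul2l c_gt0) -byc yd; apply/eqP; ring.
Qed.

(** * Squares modulo a prime congruent to 5 modulo 8 *)

Lemma Fp_fermat p (x : 'F_p) n : prime p -> n.+1 = p -> (x != 0 -> x ^+ n = 1)%R.
Proof.
move=> p_prime np x0; apply: (mulfI x0); rewrite -exprS mulr1 np.
by have := expf_card x; rewrite card_Fp.
Qed.

(** The polynomial [X^((p-1)/2) - 1] has too few roots to vanish on all nonzero
    elements; where it does not vanish, the power is [-1], and it is itself a
    square because [(p-1)/2] is even. *)
Lemma sqrtN1_Fp p : prime p -> p %% 4 = 1 -> exists i : 'F_p, (i ^+ 2 = -1)%R.
Proof.
move=> p_prime pmod4.
pose k := p %/ 4.
have pk : p = (2 * k).*2.+1 by rewrite /k; lia.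
have k_gt0 : 0 < 2 * k by have := prime_gt1 p_prime; lia.
have fermat (x : 'F_p) : (x != 0)%R -> (x ^+ (2 * k) ^+ 2 = 1)%R.
  by move=> x0; rewrite -exprM (Fp_fermat p_prime) // pk muln2.
have [x x0 xk] : exists2 x : 'F_p, (x != 0)%R & (x ^+ (2 * k) != 1)%R.
  apply/exists_inP; rewrite -[X in is_true X]negbK; apply/negP => /exists_inPn h.
  pose P : {poly 'F_p} := ('X^(2 * k) - 1)%R.
  have sP : size P = (2 * k).+1 by rewrite size_XnsubC.
  have P0 : P != 0%R by rewrite -size_poly_eq0 sP.
  have := @max_poly_roots _ P (enum (predC1 (0 : 'F_p)%R)) P0.
  rewrite enum_uniq -cardE cardC1 card_Fp // sP => /(_ _ isT).
  have -> : all (root P) (enum (predC1 (0 : 'F_p)%R)).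
    apply/allP => x; rewrite mem_enum /= => /h.
    by rewrite negbK rootE !hornerE subr_eq0.
  by move=> /(_ isT); rewrite {1}pk; lia.
exists (x ^+ k)%R; rewrite -exprM mulnC.
have := fermat x x0; move/eqP; rewrite sqrf_eq1 (negbTE xk) => /eqP //.
Qed.

(** With [i^2 = -1] one has [(1 + i)^4 = -4], so a solution with [y] nonzero
    would make [-1] a fourth power; its root would have order 8, but 8 does not
    divide [p - 1].  The fourth powers treat [2] and [-2] at once. *)
Lemma Fp_quartic_eq0 p (x y : 'F_p) : prime p -> p %% 8 = 5 ->
  (x ^+ 4 = 4%:R * y ^+ 4 -> y = 0)%R.
Proof.
move=> p_prime pmod8 xy; apply/eqP; apply/negPn/negP => y0.
have [|i i2] := sqrtN1_Fp p_prime; first by lia.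
have two_neq0 : (2%:R != 0 :> 'F_p)%R.
  by rewrite -(dvdn_pcharf (pchar_Fp p_prime)); apply/negP => /dvdn_leq; lia.
have i4 : ((1 + i) ^+ 4 = - 4%:R)%R.
  have -> : ((1 + i) ^+ 4 = (i ^+ 2 + 1 + 2%:R * i) ^+ 2)%R by ring.
  by rewrite i2 addNr add0r exprMn i2; ring.
have four_neq0 : (4%:R != 0 :> 'F_p)%R.
  by rewrite (natrM _ 2 2) mulf_neq0.
have yi0 : ((1 + i) * y != 0)%R.
  apply/eqP => /(congr1 (fun t => t ^+ 4)%R); apply/eqP.
  by rewrite exprMn i4 expr0n mulf_neq0 ?oppr_eq0 ?expf_neq0.
pose s := (x / ((1 + i) * y))%R.
have s4 : (s ^+ 4 = -1)%R.
  apply: (mulIf (expf_neq0 4 yi0)).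
  by rewrite -exprMn /s divfK // xy exprMn i4 mulN1r mulNr opprK.
have s0 : s != 0%R.
  by apply: contra_eq_neq s4 => ->; rewrite expr0n eq_sym oppr_eq0 oner_eq0.
have : (s ^+ (4 * (2 * (p %/ 8)).+1) = 1)%R by apply: Fp_fermat => //; lia.
rewrite exprM s4 exprS exprM sqrrN !expr1n mulr1 => /eqP.
by rewrite eq_sym -subr_eq0 opprK (negbTE two_neq0).
Qed.

Lemma Fp_sqr_twice p (x y : 'F_p) : prime p -> p %% 8 = 5 ->
  (x ^+ 2 = 2%:R * y ^+ 2 \/ x ^+ 2 = - (2%:R * y ^+ 2) -> x = 0 /\ y = 0)%R.
Proof.
move=> p_prime pmod8 xy.
have y0 : y = 0%R.
  apply: (Fp_quartic_eq0 p_prime pmod8 (x := x)).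
  by rewrite (exprM x 2 2); case: xy => ->; ring.
split=> //; apply/eqP; rewrite -sqrf_eq0.
by case: xy => ->; rewrite y0 expr0n /= mulr0 ?oppr0.
Qed.

Lemma coprime_not_both_dvd p b c : prime p -> coprime b c ->
  ~ ((b%:R = 0 :> 'F_p) /\ (c%:R = 0 :> 'F_p))%R.
Proof.
move=> p_prime cbc [/eqP b0 /eqP c0].
have pb : p %| b by rewrite (dvdn_pcharf (pchar_Fp p_prime)).
have pc : p %| c by rewrite (dvdn_pcharf (pchar_Fp p_prime)).
have : p %| gcdn b c by rewrite dvdn_gcd pb pc.
by rewrite (eqP cbc) dvdn1; case: eqP p_prime => // ->.
Qed.

(** * The descent *)

Definition solution p x y z := (x ^ 2 + y ^ 2) ^ 2 + (2 * p * x * y) ^ 2 = z ^ 2.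

(** The product [x y] is the quantity that the descent decreases. *)
Definition smaller_solution p N := exists x y z,
  [/\ 0 < x, 0 < y, coprime x y, solution p x y z & x * y < N].

Lemma smaller_solutionW p M N : M <= N ->
  smaller_solution p M -> smaller_solution p N.
Proof.
move=> leMN [x [y [z [x0 y0 cxy sxy lt]]]].
by exists x, y, z; split=> //; apply: leq_trans leMN.
Qed.

Lemma dvdn_twice_prime q k : prime q -> k %| 2 * q ->
  [\/ k = 1, k = 2, k = q | k = 2 * q].
Proof.
move=> q_prime kq.
have dvd2 m : m %| 2 -> m = 1 \/ m = 2.
  by move=> m2; have := dvdn_leq (isT : 0 < 2) m2; case: m m2 => [|[|[|]]] //; auto.
have [/dvdnP [m km]|qk] := boolP (q %| k).
  have : m %| 2 by rewrite -(@dvdn_pmul2r q) ?prime_gt0 // -km.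
  by case/dvd2=> m1; subst; [constructor 3|constructor 4]; rewrite ?mul1n.
have : k %| 2 by rewrite -(@Gauss_dvdl _ _ q) // coprime_sym prime_coprime.
by case/dvd2; [constructor 1|constructor 2].
Qed.

(** The common shape of all three cases of the descent: the quotient
    [k = Q / a^2] is the only unknown left, and eliminating variables then
    confines it to the divisors of [p^2 + 1]. *)
Lemma sqr_proportional a d U V Q : 0 < a -> coprime a d ->
  a ^ 2 * U = a ^ 2 * V + d ^ 2 * Q ->
  exists k, Q = k * a ^ 2 /\ U = V + k * d ^ 2.
Proof.
move=> a0 cad E.
have : a ^ 2 %| d ^ 2 * Q.
  have <- := dvdn_addr (d ^ 2 * Q) (dvdn_mulr V (dvdnn (a ^ 2))).
  by rewrite -E dvdn_mulr.
rewrite Gauss_dvdr ?coprimeXl ?coprimeXr // => /dvdnP [k kE].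
exists k; split=> //; apply/eqP; rewrite -(@eqn_pmul2l (a ^ 2)) ?expn_gt0 ?a0 //.
by rewrite E kE; apply/eqP; ring.
Qed.

(** In the descent, common divisors of [k] and [u] are only seen to divide a
    square [v^2] with [v] coprime to [u]. *)
Lemma coprime_from_sqr k u v : coprime u v ->
  (forall g, g %| k -> g %| u -> g %| v ^ 2) -> coprime k u.
Proof.
move=> cuv h; rewrite /coprime -dvdn1.
have gv := h _ (dvdn_gcdl k u) (dvdn_gcdr k u).
have : coprime (gcdn k u) (v ^ 2).
  by rewrite coprimeXr // (coprime_dvdl (dvdn_gcdr _ _)).
by rewrite /coprime (gcdn_idPl gv) => /eqP ->.
Qed.

(** Two triples share the even leg [b = 2uv]; parametrising the second one by
    [u^2 + v^2 = p c] turns the first, multiplied by [p^2], into the equation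
    for [u], [v], with [z = p a]. *)
Lemma smaller_solution_hypotenuse p a b c d :
  odd p -> odd a -> odd c -> 0 < b ->
  coprime d b ->
  c ^ 2 + b ^ 2 = a ^ 2 -> d ^ 2 + b ^ 2 = (p * c) ^ 2 ->
  smaller_solution p b.
Proof.
move=> op oa oc b0 cdb cba dbc.
have eb : odd b = false.
  by have := congr1 odd cba; rewrite oddD !oddX /= oa oc; case: (odd b).
have od : odd d.
  by have := congr1 odd dbc; rewrite oddD !oddX oddM /= op oc eb addbF.
have [u [v [cuv _ _ buv pc]]] := pythagorean_triple od cdb dbc.
have /andP [u0 v0] : (0 < u) && (0 < v).
  by move: b0; rewrite buv !muln_gt0.
exists u, v, (p * a); split=> //; last first.
  by rewrite buv -mulnA ltn_Pmull // muln_gt0 u0.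
have e : 2 * p * u * v = p * b by rewrite buv; ring.
by rewrite /solution e -pc !expnMn -mulnDr cba.
Qed.

(** Here [b = 2uv] and [c = u^2 + v^2], so the second triple is literally the
    equation for [u], [v], with [z = a]. *)
Lemma smaller_solution_leg p a b c d :
  odd p -> odd a -> odd c -> 0 < b ->
  coprime d b ->
  d ^ 2 + b ^ 2 = c ^ 2 -> c ^ 2 + (p * b) ^ 2 = a ^ 2 ->
  smaller_solution p b.
Proof.
move=> op oa oc b0 cdb dbc cba.
have eb : odd b = false.
  by have := congr1 odd cba; rewrite oddD !oddX oddM /= op oa oc; case: (odd b).
have od : odd d.
  by have := congr1 odd dbc; rewrite oddD !oddX /= oc eb addbF.
have [u [v [cuv _ _ buv cE]]] := pythagorean_triple od cdb dbc.
have /andP [u0 v0] : (0 < u) && (0 < v).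
  by move: b0; rewrite buv !muln_gt0.
exists u, v, a; split=> //; last first.
  by rewrite buv -mulnA ltn_Pmull // muln_gt0 u0.
have e : 2 * p * u * v = p * b by rewrite buv; ring.
by rewrite /solution e -cE.
Qed.

(** The case [m = p a c], [n = b d] of the descent: [k] satisfies
    [c^2 + b^2 = k a^2] and [p^2 c^2 = b^2 + k d^2]. *)
Lemma smaller_solution_p_dvd_m p q a b c d :
  prime p -> p %% 8 = 5 -> prime q -> p ^ 2 + 1 = 2 * q ->
  [&& 0 < a, 0 < b, 0 < c & 0 < d] -> odd a -> odd c ->
  coprime (a * b) (c * d) -> coprime (a * c) (b * d) ->
  (a * b) ^ 2 + (c * d) ^ 2 + (b * d) ^ 2 = (p * (a * c)) ^ 2 ->
  smaller_solution p (a * b * (c * d)).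
Proof.
move=> p_prime p8; have op : odd p by lia.
move=> q_prime pq /and4P [a0 b0 c0 d0] oa oc cx cm E.
move: cx cm; rewrite !coprimeMl !coprimeMr.
move=> /andP [/andP [cac cad] /andP [cbc cbd]] /andP [/andP [cab _] /andP [ccb ccd]].
have [k [kE1 kE2]] : exists k,
  c ^ 2 + b ^ 2 = k * a ^ 2 /\ p ^ 2 * c ^ 2 = b ^ 2 + k * d ^ 2.
  apply: sqr_proportional => //.
  have -> : a ^ 2 * (p ^ 2 * c ^ 2) = (p * (a * c)) ^ 2 by ring.
  by rewrite -E; ring.
have kdvd : k %| 2 * q.
  have kc : coprime k (c ^ 2).
    rewrite coprimeXr // (@coprime_from_sqr _ _ b) // => g gk gc.
    by rewrite -(@dvdn_addr (c ^ 2)) ?dvdn_exp // kE1 dvdn_mulr.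
  rewrite -(Gauss_dvdl _ kc) -pq.
  (* [p^2 c^2 + c^2 = k (a^2 + d^2)] is the sum of the two relations. *)
  apply/dvdnP; exists (a ^ 2 + d ^ 2); move: kE1 kE2; clear.
  by move: (a ^ 2) (b ^ 2) (c ^ 2) (d ^ 2) (p ^ 2) => A B C D P; lia.
have p0 : (p%:R = 0 :> 'F_p)%R by rewrite pchar_Fp_0.
case: (dvdn_twice_prime q_prime kdvd) => kk; subst k.
- apply: (@smaller_solutionW _ b).
    by rewrite dvdn_leq ?muln_gt0 ?a0 ?b0 ?c0 // dvdn_mulr // dvdn_mull.
  apply: (@smaller_solution_hypotenuse p a b c d) => //;
    first by rewrite coprime_sym.
    by rewrite kE1 mul1n.
  by rewrite expnMn kE2 mul1n addnC.
- case: (@coprime_not_both_dvd p b d) => //.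
  apply: Fp_sqr_twice => //; right; apply/eqP.
  have := congr1 (fun n => n%:R : 'F_p)%R kE2.
  by rewrite !(natrX, natrD, natrM) p0 expr0n mul0r /= => /esym/eqP; rewrite addr_eq0.
- case: (@coprime_not_both_dvd p d b) => //;
    first by rewrite coprime_sym.
  apply: Fp_sqr_twice => //; right; apply/eqP.
  (* Doubling replaces [q], the inverse of 2 modulo [p], by [p^2 + 1]. *)
  have kE3 : 2 * (p ^ 2 * c ^ 2) = 2 * b ^ 2 + (p ^ 2 + 1) * d ^ 2.
    by rewrite pq kE2; ring.
  have := congr1 (fun n => n%:R : 'F_p)%R kE3.
  rewrite !(natrX, natrD, natrM) p0 expr0n mul0r mulr0 /= add0r mul1r addrC.
  by move=> /esym/eqP; rewrite addr_eq0.
- apply: (@smaller_solutionW _ d).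
    by rewrite dvdn_leq ?muln_gt0 ?a0 ?b0 ?c0 // !dvdn_mull.
  (* The sum of the two relations is divisible by [p^2 + 1]; dividing it out
     exchanges the roles of [(a, b)] and [(c, d)]. *)
  rewrite -pq in kE1 kE2.
  have cE : a ^ 2 + d ^ 2 = c ^ 2.
    apply/eqP; rewrite -(@eqn_pmul2l (p ^ 2 + 1)) ?addn1 //; apply/eqP.
    move: kE1 kE2; clear.
    by move: (a ^ 2) (b ^ 2) (c ^ 2) (d ^ 2) (p ^ 2) => A B C D P; lia.
  apply: (@smaller_solution_hypotenuse p c d a b) => //;
    rewrite expnMn; move: kE1 cE; clear.
  by move: (a ^ 2) (b ^ 2) (c ^ 2) (d ^ 2) (p ^ 2) => A B C D P; lia.
Qed.

(** The case [m = a c], [n = p b d] of the descent: [k] satisfies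
    [c^2 + p^2 b^2 = k a^2] and [c^2 = b^2 + k d^2]. *)
Lemma smaller_solution_p_dvd_n p q a b c d :
  prime p -> p %% 8 = 5 -> prime q -> p ^ 2 + 1 = 2 * q ->
  [&& 0 < a, 0 < b, 0 < c & 0 < d] -> odd a -> odd c ->
  coprime (a * b) (c * d) -> coprime (a * c) (b * d) ->
  (a * b) ^ 2 + (c * d) ^ 2 + (p * (b * d)) ^ 2 = (a * c) ^ 2 ->
  smaller_solution p (a * b * (c * d)).
Proof.
move=> p_prime p8; have op : odd p by lia.
move=> q_prime pq /and4P [a0 b0 c0 d0] oa oc cx cm E.
move: cx cm; rewrite !coprimeMl !coprimeMr.
move=> /andP [/andP [cac cad] /andP [cbc cbd]] /andP [/andP [cab _] /andP [ccb ccd]].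
have [k [kE1 kE2]] : exists k,
  c ^ 2 + p ^ 2 * b ^ 2 = k * a ^ 2 /\ c ^ 2 = b ^ 2 + k * d ^ 2.
  apply: sqr_proportional => //.
  by rewrite -expnMn -E; ring.
have kdvd : k %| 2 * q.
  have kb : coprime k (b ^ 2).
    rewrite coprimeXr // (@coprime_from_sqr _ _ c) //.
    by move=> g gk gb; rewrite kE2 dvdn_add ?dvdn_exp // dvdn_mulr.
  rewrite -(Gauss_dvdl _ kb) -pq.
  rewrite -(@dvdn_addl (k * d ^ 2)) ?dvdn_mulr //.
  apply/dvdnP; exists (a ^ 2); move: kE1 kE2; clear.
  by move: (a ^ 2) (b ^ 2) (c ^ 2) (d ^ 2) (p ^ 2) => A B C D P; lia.
have p0 : (p%:R = 0 :> 'F_p)%R by rewrite pchar_Fp_0.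
case: (dvdn_twice_prime q_prime kdvd) => kk; subst k.
- apply: (@smaller_solutionW _ b).
    by rewrite dvdn_leq ?muln_gt0 ?a0 ?b0 ?c0 // dvdn_mulr // dvdn_mull.
  apply: (@smaller_solution_leg p a b c d) => //;
    first by rewrite coprime_sym.
    by rewrite kE2 mul1n addnC.
  by rewrite expnMn kE1 mul1n.
- case: (@coprime_not_both_dvd p c a) => //;
    first by rewrite coprime_sym.
  apply: Fp_sqr_twice => //; left.
  have := congr1 (fun n => n%:R : 'F_p)%R kE1.
  by rewrite !(natrX, natrD, natrM) p0 expr0n mul0r /= addr0.
- case: (@coprime_not_both_dvd p a c) => //.
  apply: Fp_sqr_twice => //; left.
  have kE3 : 2 * c ^ 2 + p ^ 2 * (2 * b ^ 2) = (p ^ 2 + 1) * a ^ 2.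
    by rewrite pq -mulnA -kE1; ring.
  have := congr1 (fun n => n%:R : 'F_p)%R kE3.
  by rewrite !(natrX, natrD, natrM) p0 expr0n mul0r /= add0r mul1r addr0.
- apply: (@smaller_solutionW _ d).
    by rewrite dvdn_leq ?muln_gt0 ?a0 ?b0 ?c0 // !dvdn_mull.
  (* The difference of the two relations is divisible by [p^2 + 1]; dividing it
     out exchanges the roles of [(a, b)] and [(c, d)]. *)
  rewrite -pq in kE1 kE2.
  have bE : b ^ 2 + d ^ 2 = a ^ 2.
    apply/eqP; rewrite -(@eqn_pmul2l (p ^ 2 + 1)) ?addn1 //; apply/eqP.
    move: kE1 kE2; clear.
    by move: (a ^ 2) (b ^ 2) (c ^ 2) (d ^ 2) (p ^ 2) => A B C D P; lia.
  apply: (@smaller_solution_leg p c d a b) => //;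
    rewrite expnMn; move: kE2 bE; clear.
  by move: (a ^ 2) (b ^ 2) (c ^ 2) (d ^ 2) (p ^ 2) => A B C D P; lia.
Qed.

Lemma mul_odd_sqr_mod8 k a : odd a -> k * a ^ 2 = k %[mod 8].
Proof. by case/sqr_of_odd=> s ->; rewrite mulnDr muln1 mulnCA (mulnC 8) modnMDl. Qed.

(** Here [c^2 + p b^2 = k a^2] and [p c^2 = b^2 + k d^2], where [p] and [q] are
    both 5 modulo 8, so [k] is 1, 2 or 5 modulo 8.  If [b] is odd, the first
    relation gives [k = 6]; if [b] is even, the two relations give [k = 1] and
    [k = 5] in one order or the other, according to whether 4 divides [b]. *)
Lemma no_solution_p_dvd_norm p q a b c d :
  p %% 8 = 5 -> prime q -> p ^ 2 + 1 = 2 * q ->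
  [&& 0 < a, 0 < b, 0 < c & 0 < d] -> odd a -> odd c ->
  coprime (a * b) (c * d) -> coprime (a * c) (b * d) ->
  (a * b) ^ 2 + (c * d) ^ 2 + p * (b * d) ^ 2 = p * (a * c) ^ 2 -> False.
Proof.
move=> p8 q_prime pq /and4P [a0 b0 c0 d0] oa oc cx cm E.
move: cx cm; rewrite !coprimeMl !coprimeMr.
move=> /andP [/andP [cac cad] /andP [cbc cbd]] /andP [/andP [cab _] /andP [ccb ccd]].
have [k [kE1 kE2]] : exists k,
  c ^ 2 + p * b ^ 2 = k * a ^ 2 /\ p * c ^ 2 = b ^ 2 + k * d ^ 2.
  apply: sqr_proportional => //.
  have -> : a ^ 2 * (p * c ^ 2) = p * (a * c) ^ 2 by ring.
  by rewrite -E; ring.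
have kdvd : k %| 2 * q.
  have kc : coprime k (c ^ 2).
    rewrite coprimeXr // (@coprime_from_sqr _ _ b) // => g gk gc.
    rewrite -(@dvdn_addl (k * d ^ 2)) ?(dvdn_mulr _ gk) // -kE2.
    by rewrite dvdn_mull // dvdn_exp.
  rewrite -(Gauss_dvdl _ kc) -pq.
  (* [p] times the second relation, plus the first. *)
  apply/dvdnP; exists (p * d ^ 2 + a ^ 2); move: kE1 kE2; clear.
  by rewrite (expnS p) expn1; move: (a ^ 2) (b ^ 2) (c ^ 2) (d ^ 2) => A B C D; nia.
have q8 : q %% 8 = 5.
  have [j pj] : exists j, p = 8 * j + 5 by exists (p %/ 8); move: p8; clear; lia.
  have : 2 * q = 2 * (8 * (4 * j ^ 2 + 5 * j + 1) + 5) by rewrite -pq pj; ring.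
  by clear; move: (4 * _ + _ + 1) => t; lia.
have k8 : [\/ k %% 8 = 1, k %% 8 = 2 | k %% 8 = 5].
  case: (dvdn_twice_prime q_prime kdvd) => ->; rewrite ?q8; clear - q8.
  - by constructor 1.
  - by constructor 2.
  - by constructor 3.
  - by constructor 2; lia.
have ka := mul_odd_sqr_mod8 k oa; have pc := mul_odd_sqr_mod8 p oc.
have c1 := mul_odd_sqr_mod8 1 oc; rewrite mul1n in c1.
have [ob|eb] := boolP (odd b).
  have pb := mul_odd_sqr_mod8 p ob.
  move: kE1 k8 ka pb c1 p8; clear; move: (k * _) (p * _) (c ^ 2) => u v w.
  by move=> e [] h; lia.
have od : odd d.
  have [//|ed] := boolP (odd d).
  have : 2 %| gcdn b d by rewrite dvdn_gcd !dvdn2 eb ed.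
  by rewrite (eqP cbd).
have kd := mul_odd_sqr_mod8 k od.
have [s bE] : exists s, b ^ 2 = 4 * s.
  by have [t ->] := even_double eb; exists (t ^ 2); ring.
have [j pj] : exists j, p = 8 * j + 5 by exists (p %/ 8); move: p8; clear; lia.
have pbE : p * b ^ 2 = 8 * (j * b ^ 2) + 5 * b ^ 2 by rewrite pj; ring.
move: kE1 kE2 k8 ka kd pc c1 p8 pbE; rewrite bE; clear.
move: (k * a ^ 2) (k * d ^ 2) (p * c ^ 2) (c ^ 2) (p * (4 * s)) (j * (4 * s)) => u v w x y z.
by move=> e1 e2 [] h; lia.
Qed.

Lemma coprime_sum_sqr x y : coprime x y -> coprime (x ^ 2 + y ^ 2) (x * y).
Proof.
move=> cxy; rewrite coprimeMr; apply/andP; split.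
  apply: (@coprime_from_sqr _ x y) => // g gk gx.
  by rewrite -(@dvdn_addr (x ^ 2)) ?dvdn_exp.
apply: (@coprime_from_sqr _ y x) => [|g gk gy]; first by rewrite coprime_sym.
by rewrite -(@dvdn_addl (y ^ 2)) ?dvdn_exp.
Qed.

Lemma sum_sqr_mod4 x y : odd (x + y) -> (x ^ 2 + y ^ 2) %% 4 = 1.
Proof.
have mod4 u v : odd u -> ~~ odd v -> (u ^ 2 + v ^ 2) %% 4 = 1.
  move=> /sqr_of_odd [s ->] /even_double [t ->].
  have -> : 8 * s + 1 + (2 * t) ^ 2 = (2 * s + t ^ 2) * 4 + 1 by ring.
  by rewrite modnMDl.
rewrite oddD; have [ox|ex] := boolP (odd x); have [oy|ey] := boolP (odd y) => // _.
  exact: mod4.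
by rewrite addnC; exact: mod4.
Qed.

(** Decides which of the two parameters of a triple is the even one, which the
    congruences of the descent depend on. *)
Lemma sqr_difference_mod4 X m n : X %% 4 = 1 -> odd (m + n) ->
  X + n ^ 2 = m ^ 2 -> odd m /\ ~~ odd n.
Proof.
move=> X4; rewrite oddD.
have [om|em] := boolP (odd m); have [on|en] := boolP (odd n) => // _.
have [s ->] := sqr_of_odd on; have [t ->] := even_double em.
rewrite expnMn; move: X4; clear; move: (t ^ 2) => u; lia.
Qed.

(** If [x] and [y] were both odd, then [z^2] would be 8 modulo 16. *)
Lemma solution_odd_sum p x y z : odd p -> coprime x y -> solution p x y z ->
  odd (x + y).
Proof.
move=> op cxy sxy; rewrite oddD.
have [ox|ex] := boolP (odd x); have [oy|ey] := boolP (odd y) => //.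
  exfalso.
  have [u pxy] : exists u, (p * x * y) ^ 2 = 8 * u + 1.
    by apply: sqr_of_odd; rewrite !oddM op ox oy.
  have [a xE] := sqr_of_odd ox; have [b yE] := sqr_of_odd oy.
  have zE : z ^ 2 = 16 * (4 * (a + b) ^ 2 + 2 * (a + b) + 2 * u) + 8.
    rewrite -sxy xE yE; have -> : 2 * p * x * y = 2 * (p * x * y) by ring.
    by rewrite expnMn pxy; ring.
  have [oz|ez] := boolP (odd z).
    by move: (congr1 odd zE); rewrite !(oddX, oddD, oddM) /= oz.
  have [w zw] := even_double ez.
  have [ow|ew] := boolP (odd w).
    have [t tE] := sqr_of_odd ow; move: zE; rewrite zw expnMn tE; clear.
    by move: (4 * (_ + _) ^ 2 + _ + _) => s; lia.
  have [t tE] := even_double ew; move: zE; rewrite zw tE; clear.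
  have -> : (2 * (2 * t)) ^ 2 = 16 * t ^ 2 by ring.
  by move: (4 * (_ + _) ^ 2 + _ + _) (t ^ 2) => s t'; lia.
have : 2 %| gcdn x y by rewrite dvdn_gcd !dvdn2 ex ey.
by rewrite (eqP cxy).
Qed.

(** Splits according to whether [p] divides [x^2 + y^2], [m] or [n]. *)
Lemma smaller_solution_exists p q x y z : prime p -> p %% 8 = 5 -> prime q ->
  p ^ 2 + 1 = 2 * q -> 0 < x -> 0 < y -> coprime x y -> solution p x y z ->
  smaller_solution p (x * y).
Proof.
move=> p_prime p8 q_prime pq x0 y0 cxy sxy.
have op : odd p by move: p8; clear; lia.
have oxy := solution_odd_sum op cxy sxy.
have odd_norm : odd (x ^ 2 + y ^ 2) by rewrite oddD !oddX /= -oddD.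
have cnorm : coprime (x ^ 2 + y ^ 2) (2 * (x * y)).
  by rewrite coprimeMr coprimen2 odd_norm coprime_sum_sqr.
have xy0 : 0 < x * y by rewrite muln_gt0 x0.
have [pnorm|pnorm] := boolP (p %| x ^ 2 + y ^ 2).
  exfalso.
  have [X XE] := dvdnP pnorm.
  have /dvdnP [w zw] : p %| z.
    have : p %| z ^ 2.
      rewrite -sxy dvdn_add ?dvdn_exp //.
      have -> : 2 * p * x * y = p * (2 * x * y) by ring.
      by rewrite dvdn_mulr.
    by rewrite Euclid_dvdX // => /andP [].
  have sw : X ^ 2 + (2 * (x * y)) ^ 2 = w ^ 2.
    apply/eqP; rewrite -(@eqn_pmul2r (p ^ 2)) ?expn_gt0 ?prime_gt0 //; apply/eqP.
    by rewrite -expnMn -zw -sxy XE; ring.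
  have oX : odd X by move: odd_norm; rewrite XE oddM => /andP [].
  have cX : coprime X (2 * (x * y)).
    by apply: coprime_dvdl cnorm; rewrite XE dvdn_mulr.
  have [m [n [cmn omn XE' xymn _]]] := pythagorean_triple oX cX sw.
  have X4 : X %% 4 = 1.
    have := sum_sqr_mod4 oxy; rewrite XE.
    have [j ->] : exists j, p = 4 * j + 1 by exists (p %/ 4); move: p8; clear; lia.
    by rewrite mulnDr muln1 mulnCA mulnC modnMDl.
  have [om en] := sqr_difference_mod4 X4 omn XE'.
  have xymn' : x * y = m * n.
    by apply/eqP; rewrite -(@eqn_pmul2l 2) // xymn mulnA.
  have m0 : 0 < m by move: om; case: (m).
  have [a [b [c [d [xE yE mE nE]]]]] := four_numbers x0 m0 xymn'.
  have /andP [oa oc] : odd a && odd c by rewrite -oddM -mE.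
  apply: (@no_solution_p_dvd_norm p q a b c d) => //;
    rewrite -?xE -?yE -?mE -?nE //.
    by move: x0 y0; rewrite xE yE !muln_gt0 => /andP [-> ->] /andP [-> ->].
  by rewrite -XE' mulnDr XE (mulnC X).
have opn : coprime (x ^ 2 + y ^ 2) (2 * p * x * y).
  have -> : 2 * p * x * y = p * (2 * (x * y)) by ring.
  by rewrite coprimeMr cnorm andbT coprime_sym prime_coprime.
have [m [n [cmn omn nE xymn _]]] := pythagorean_triple odd_norm opn sxy.
have pmn : p * (x * y) = m * n.
  by apply/eqP; rewrite -(@eqn_pmul2l 2) // !mulnA xymn.
have [om en] := sqr_difference_mod4 (sum_sqr_mod4 oxy) omn nE.
have m0 : 0 < m by move: om; case: (m).
have p0 := prime_gt0 p_prime.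
have : p %| m * n by rewrite -pmn dvdn_mulr.
rewrite Euclid_dvdM // => /orP [] /dvdnP [l lE].
- rewrite mulnC in lE.
  have xymn' : x * y = l * n.
    by apply/eqP; rewrite -(@eqn_pmul2l p) // pmn lE mulnA.
  have l0 : 0 < l by move: m0; rewrite lE muln_gt0 => /andP [].
  have [a [b [c [d [xE yE l_E n_E]]]]] := four_numbers x0 l0 xymn'.
  have /andP [oa oc] : odd a && odd c.
    by rewrite -oddM -l_E; move: om; rewrite lE oddM => /andP [].
  rewrite xE yE.
  apply: (@smaller_solution_p_dvd_m p q a b c d) => //;
    rewrite -?xE -?yE -?l_E -?n_E //.
  + by move: x0 y0; rewrite xE yE !muln_gt0 => /andP [-> ->] /andP [-> ->].
  + by apply: coprime_dvdl cmn; rewrite lE dvdn_mull.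
  + by rewrite nE lE.
- rewrite mulnC in lE.
  have xymn' : x * y = m * l.
    by apply/eqP; rewrite -(@eqn_pmul2l p) // pmn lE mulnCA.
  have [a [b [c [d [xE yE m_E l_E]]]]] := four_numbers x0 m0 xymn'.
  have /andP [oa oc] : odd a && odd c by rewrite -oddM -m_E.
  rewrite xE yE.
  apply: (@smaller_solution_p_dvd_n p q a b c d) => //;
    rewrite -?xE -?yE -?l_E -?m_E //.
  + by move: x0 y0; rewrite xE yE !muln_gt0 => /andP [-> ->] /andP [-> ->].
  + by apply: coprime_dvdr cmn; rewrite lE dvdn_mull.
  + by rewrite -lE.
Qed.

Lemma no_solution p q x y z : prime p -> p %% 8 = 5 -> prime q ->
  p ^ 2 + 1 = 2 * q -> 0 < x -> 0 < y -> coprime x y -> ~ solution p x y z.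
Proof.
move=> p_prime p8 q_prime pq.
have [N leN] := ubnP (x * y); elim: N x y z leN => // N IHN x y z leN x0 y0 cxy sxy.
have [x' [y' [z' [x'0 y'0 cxy' sxy' lt]]]] :=
  smaller_solution_exists p_prime p8 q_prime pq x0 y0 cxy sxy.
by apply: (IHN x' y' z') => //; apply: leq_trans lt _.
Qed.

(** * From sides to solutions *)

Local Open Scope ring_scope.

(** The number [z] of the correspondence is obtained as a rational whose square
    is a natural number. *)
Lemma nat_sqr_of_rat (r : rat) (N : nat) :
  r ^+ 2 = N%:R -> exists z, (z ^ 2)%N = N.
Proof.
move=> rN; pose m := `|numq r|%N; pose n := `|denq r|%N.
have n_gt0 : (0 < n)%N by rewrite absz_gt0 denq_neq0.
have mn : (m ^ 2)%N = (N * n ^ 2)%N.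
  apply/eqP; rewrite -(eqr_nat rat) natrM !natrX -rN.
  rewrite /m /n !natr_absz !intr_norm !real_normK ?num_real //.
  by rewrite -exprMn numqE.
have /dvdnP [z mz] : (n %| m)%N.
  by rewrite -(@dvdn_pexp2r n m 2) // mn dvdn_mull.
exists z; apply/eqP; rewrite -(@eqn_pmul2r (n ^ 2)) ?expn_gt0 ?n_gt0 //.
by rewrite -mn mz expnMn.
Qed.

(** From [c^2 - (a - b)^2 = 4] the number [s = (c + (a - b))/2] has inverse
    [(c - (a - b))/2], and [(a + b)^2 = c^2 + 4p^2 = (s + 1/s)^2 + 4p^2];
    clearing the denominators of [s = x/y] gives the equation. *)
Lemma solution_of_rat (p : nat) (a b c : rat) : 0 < a -> 0 < b -> 0 < c ->
  a * b = p%:R ^+ 2 + 1 -> c ^+ 2 = (a - b) ^+ 2 + 4%:R -> has_coprime_solution p.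
Proof.
move=> a0 b0 c0 ab cE.
pose s := (c + (a - b)) / 2%:R.
have s_gt0 : 0 < s.
  have : (a - b) ^+ 2 < c ^+ 2 by rewrite cE ltrDl.
  by move=> ?; rewrite divr_gt0 //; nra.
have sV : s^-1 = (c - (a - b)) / 2%:R.
  apply: (mulfI (lt0r_neq0 s_gt0)); rewrite mulfV ?lt0r_neq0 // /s.
  transitivity ((c ^+ 2 - (a - b) ^+ 2) / 4%:R); first by rewrite cE; field.
  by field.
pose x := `|numq s|%N; pose y := `|denq s|%N.
have sxy : s = x%:R / y%:R.
  rewrite /x /y !natr_absz !gtr0_norm ?denq_gt0 ?numq_gt0 //.
  by rewrite divq_num_den.
have y_gt0 : (0 < y)%N by rewrite absz_gt0 denq_neq0.
have x_gt0 : (0 < x)%N by rewrite absz_gt0 numq_eq0 lt0r_neq0.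
have cxy : coprime x y by exact: coprime_num_den.
have [z zE] : exists z, (z ^ 2 = (x ^ 2 + y ^ 2) ^ 2 + (2 * p * x * y) ^ 2)%N.
  apply: (@nat_sqr_of_rat ((a + b) * x%:R * y%:R)).
  have xn0 : x%:R != 0 :> rat by rewrite pnatr_eq0 -lt0n.
  have yn0 : y%:R != 0 :> rat by rewrite pnatr_eq0 -lt0n.
  have -> : ((a + b) * x%:R * y%:R) ^+ 2
     = ((s + s^-1) ^+ 2 + 4%:R * p%:R ^+ 2) * (x%:R * y%:R) ^+ 2.
    rewrite sV /s.
    have -> : (c + (a - b)) / 2 + (c - (a - b)) / 2 = c by field.
    have -> : p%:R ^+ 2 = a * b - 1 by rewrite ab addrK.
    by rewrite cE; ring.
  rewrite sxy !(natrX, natrD, natrM); field.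
  by rewrite xn0 yn0.
exists x, y, z; split=> //.
by rewrite -(@ltn_exp2r 0 z 2) // zE addn_gt0 !expn_gt0 addn_gt0 expn_gt0 x_gt0.
Qed.

(** * Plane geometry *)

Lemma dotpE (R : realType) (u v : 'rV[R]_2) :
  dotp u v = u 0 0 * v 0 0 + u 0 1 * v 0 1.
Proof.
by rewrite /dotp !big_ord_recl big_ord0 addr0; congr (_ + _ * _); congr (_ _ _);
   apply: val_inj.
Qed.

Lemma det_mx2 (R : comNzRingType) (M : 'M[R]_2) :
  \det M = M 0 0 * M 1 1 - M 0 1 * M 1 0.
Proof.
have l01 : lift ord0 ord0 = 1 :> 'I_2 by apply: val_inj.
have l10 : lift (1 : 'I_2) 0 = 0 by apply: val_inj.
rewrite (expand_det_row _ 0) !big_ord_recl big_ord0 addr0 /cofactor !det_mx11.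
by rewrite !mxE !l01 !l10 expr0 expr1 mul1r mulN1r mulrN.
Qed.

Lemma det_edgesE (R : realType) (A B C : 'rV[R]_2) :
  \det (edges A B C) =
  (B - A) 0 0 * (C - A) 0 1 - (B - A) 0 1 * (C - A) 0 0.
Proof.
have row0 j : edges A B C 0 j = (B - A) 0 j.
  by rewrite -(col_mxEu (B - A) (C - A)); congr (_ _ _); apply: val_inj.
have row1 j : edges A B C 1 j = (C - A) 0 j.
  by rewrite -(col_mxEd (B - A) (C - A)); congr (_ _ _); apply: val_inj.
by rewrite det_mx2 !row0 !row1.
Qed.

Lemma cos_double_of_tan (R : realType) (p h : R) : p != 0 ->
  tan h = 1 / p -> cos (h *+ 2) = (p ^+ 2 - 1) / (p ^+ 2 + 1).
Proof.
move=> p0 th.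
have ch : cos h != 0.
  apply/eqP => ch; move: th; rewrite /tan ch invr0 mulr0 => /esym/eqP.
  by rewrite div1r invr_eq0 (negbTE p0).
have p1 : p ^+ 2 + 1 != 0 by rewrite lt0r_neq0 // ltr_wpDl ?sqr_ge0.
have := cos2_tan2 ch; rewrite th => c2.
have {}c2 : cos h ^+ 2 = p ^+ 2 / (p ^+ 2 + 1).
  apply: invr_inj; rewrite c2; field.
  by rewrite p0 p1.
by rewrite cos_mulr2n c2; field.
Qed.

Lemma dotp_ge0 (R : realType) (u : 'rV[R]_2) : 0 <= dotp u u.
Proof. by rewrite dotpE -!expr2 addr_ge0 ?sqr_ge0. Qed.

Lemma eucl_norm_sqr (R : realType) (u : 'rV[R]_2) : eucl_norm u ^+ 2 = dotp u u.
Proof. by rewrite sqr_sqrtr ?dotp_ge0. Qed.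

Lemma eucl_norm_ge0 (R : realType) (u : 'rV[R]_2) : 0 <= eucl_norm u.
Proof. exact: sqrtr_ge0. Qed.

Lemma eucl_distC (R : realType) (A B : 'rV[R]_2) : eucl_dist A B = eucl_dist B A.
Proof. by rewrite /eucl_dist /eucl_norm !dotpE !mxE; congr Num.sqrt; ring. Qed.

(** This replaces the sine of the angle: it expresses the area through the
    sides and the scalar product alone. *)
Lemma lagrange_identity (R : realType) (A B C : 'rV[R]_2) :
  (eucl_dist A C * eucl_dist A B) ^+ 2
    = dotp (C - A) (B - A) ^+ 2 + \det (edges A B C) ^+ 2.
Proof. by rewrite exprMn !eucl_norm_sqr det_edgesE !dotpE; ring. Qed.

Lemma law_of_cosines (R : realType) (A B C : 'rV[R]_2) :
  eucl_dist B C ^+ 2 =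
  eucl_dist A C ^+ 2 + eucl_dist A B ^+ 2 - dotp (C - A) (B - A) *+ 2.
Proof. by rewrite !eucl_norm_sqr !dotpE !mxE; ring. Qed.

Lemma det_sqr_area (R : realType) (A B C : 'rV[R]_2) :
  \det (edges A B C) ^+ 2 = (triangle_area A B C *+ 2) ^+ 2.
Proof.
by rewrite /triangle_area mulr2n -splitr real_normK ?num_real.
Qed.

(** Since the squared product of the adjacent sides is [w^2 + (2p)^2], with [w]
    their scalar product, and [w] is that product times a known cosine, the
    product [a b] is determined by [p]. *)
Lemma triangle_sides (R : realType) (p : R) (A B C : 'rV[R]_2) : 0 < p ->
  triangle_area A B C = p -> tan (angle C A B / 2) = 1 / p ->
  [/\ 0 < eucl_dist A B, 0 < eucl_dist C A, 0 < eucl_dist B C,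
      eucl_dist C A * eucl_dist A B = p ^+ 2 + 1
    & eucl_dist B C ^+ 2 = (eucl_dist C A - eucl_dist A B) ^+ 2 + 4].
Proof.
move=> p0 areaE tanE; rewrite (eucl_distC C A).
set a := eucl_dist A C; set b := eucl_dist A B; set c := eucl_dist B C.
set w := dotp (C - A) (B - A).
have ab2 : (a * b) ^+ 2 = w ^+ 2 + (p *+ 2) ^+ 2.
  by rewrite -areaE -det_sqr_area; exact: lagrange_identity.
have a_ge0 : 0 <= a by exact: eucl_norm_ge0.
have b_ge0 : 0 <= b by exact: eucl_norm_ge0.
have c_ge0 : 0 <= c by exact: eucl_norm_ge0.
have ab_gt0 : 0 < a * b.
  rewrite lt_def mulr_ge0 // andbT; apply/eqP => ab0.
  by move: ab2; rewrite ab0 => ?; nra.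
have a_gt0 : 0 < a.
  rewrite lt_def a_ge0 andbT; apply: contraTneq ab_gt0 => ->.
  by rewrite mul0r ltxx.
have b_gt0 : 0 < b.
  rewrite lt_def b_ge0 andbT; apply: contraTneq ab_gt0 => ->.
  by rewrite mulr0 ltxx.
have Xle : -1 <= w / (a * b) <= 1.
  rewrite -ler_norml -(@ler_pXn2r _ 2) ?nnegrE // expr1n real_normK ?num_real //.
  rewrite expr_div_n ler_pdivrMr ?exprn_gt0 // mul1r ab2.
  by rewrite lerDl sqr_ge0.
have cosE : w / (a * b) = (p ^+ 2 - 1) / (p ^+ 2 + 1).
  rewrite -(cos_double_of_tan (lt0r_neq0 p0) tanE) mulr2n -splitr.
  by rewrite /angle acosK.
have p1_gt0 : 0 < p ^+ 2 + 1 by nra.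
have wE : w = a * b * ((p ^+ 2 - 1) / (p ^+ 2 + 1)).
  by rewrite -cosE mulrC divfK ?lt0r_neq0.
have abE : a * b = p ^+ 2 + 1.
  apply/eqP; rewrite -(@eqrXn2 _ 2) // ?ltW //; apply/eqP.
  have p2 : (p *+ 2) ^+ 2 != 0 by rewrite expf_neq0 // lt0r_neq0 ?mulrn_wgt0.
  apply: (mulIf p2).
  transitivity ((p ^+ 2 + 1) ^+ 2 * ((a * b) ^+ 2 - w ^+ 2)).
    by rewrite wE; field; rewrite lt0r_neq0.
  by rewrite ab2 (addrC (w ^+ 2)) addrK.
have cE : c ^+ 2 = (a - b) ^+ 2 + 4.
  rewrite /c (law_of_cosines A) -/a -/b -/w.
  have -> : w = p ^+ 2 - 1 by rewrite wE abE mulrC divfK ?lt0r_neq0.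
  have -> : p ^+ 2 = a * b - 1 by rewrite abE addrK.
  by ring.
split=> //.
have : 0 < c ^+ 2 by rewrite cE ltr_wpDl ?sqr_ge0.
by rewrite exprn_even_gt0 //= lt_def c_ge0 andbT.
Qed.

(** Only the angle at the first vertex has to be treated: the other two are
    reached by rotating the names of the vertices. *)
Lemma solution_of_triangle (R : realType) (p : nat) (A B C : 'rV[R]_2) :
  (0 < p)%N -> heron_triangle A B C ->
  triangle_area A B C = p%:R -> tan (angle C A B / 2) = 1 / p%:R ->
  has_coprime_solution p.
Proof.
move=> p0 [_ [b _ bE] [c _ cE] [a _ aE] _] areaE tanE.
have := triangle_sides _ areaE tanE; rewrite ltr0n => /(_ p0).
rewrite -aE -bE -cE !ltr0q => - [b0 a0 c0 abE cabE].
apply: (@solution_of_rat p a b c) => //.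
  apply: (fmorph_inj (@ratr R)); rewrite rmorphM abE.
  by rewrite rmorphD rmorphXn /= ratr_nat rmorph1.
apply: (fmorph_inj (@ratr R)); rewrite rmorphXn /= cabE.
by rewrite rmorphD rmorphXn rmorphB /= ratr_nat.
Qed.

Lemma det_edges_rot (R : realType) (A B C : 'rV[R]_2) :
  \det (edges B C A) = \det (edges A B C).
Proof. by rewrite !det_edgesE !mxE; ring. Qed.

Lemma area_rot (R : realType) (A B C : 'rV[R]_2) :
  triangle_area B C A = triangle_area A B C.
Proof. by rewrite /triangle_area det_edges_rot. Qed.

Lemma nondegenerateE (R : realType) (A B C : 'rV[R]_2) :
  Defs.nondegenerate A B C = (\det (edges A B C) != 0).
Proof. by rewrite /Defs.nondegenerate row_free_unit unitmxE unitfE. Qed.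

Lemma heron_rot (R : realType) (A B C : 'rV[R]_2) :
  heron_triangle A B C -> heron_triangle B C A.
Proof.
rewrite /heron_triangle !nondegenerateE (det_edges_rot A B C) (area_rot A B C).
by case=> nd ab bc ca ar; split.
Qed.

Lemma rational_natr (R : realType) (n : nat) : rational (n%:R : R).
Proof. by exists n%:R => //; rewrite ratr_nat. Qed.

(** The vertex of the prescribed angle is put at the origin, one side along the
    first axis and the other in the direction [(X, S)] of the known cosine and
    sine. *)
Lemma heron_triangle_of_sides (R : realType) (p : nat) (a b c : R) :
  (0 < p)%N -> 0 < a -> 0 < b -> 0 < c ->
  rational a -> rational b -> rational c ->
  a * b = p%:R ^+ 2 + 1 -> c ^+ 2 = (a - b) ^+ 2 + 4 ->
  exists A B C : 'rV[R]_2, [/\ heron_triangle A B C,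
     triangle_area A B C = p%:R & tan (angle C A B / 2) = 1 / p%:R].
Proof.
move=> p0 a0 b0 c0 ra rb rc abE cE.
set P : R := p%:R; have P0 : 0 < P by rewrite ltr0n.
have P1 : P ^+ 2 + 1 != 0 by rewrite lt0r_neq0 //; nra.
pose X := (P ^+ 2 - 1) / (P ^+ 2 + 1); pose S := P *+ 2 / (P ^+ 2 + 1).
have XS : X ^+ 2 + S ^+ 2 = 1 by rewrite /X /S; field.
pose A : 'rV[R]_2 := 0.
pose B : 'rV[R]_2 := \row_j (if j == 0 then b else 0).
pose C : 'rV[R]_2 := \row_j (if j == 0 then a * X else a * S).
have distAB : eucl_dist A B = b.
  rewrite -(ger0_norm (ltW b0)) -sqrtr_sqr /eucl_dist /eucl_norm dotpE !mxE /=.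
  by congr Num.sqrt; ring.
have distCA : eucl_dist C A = a.
  rewrite eucl_distC -(ger0_norm (ltW a0)) -sqrtr_sqr.
  rewrite -[a ^+ 2]mulr1 -XS /eucl_dist /eucl_norm dotpE !mxE /=.
  by congr Num.sqrt; ring.
have dotE : dotp (C - A) (B - A) = a * b * X by rewrite dotpE !mxE /=; ring.
have distBC : eucl_dist B C = c.
  apply/eqP; rewrite -(@eqrXn2 _ 2) ?eucl_norm_ge0 ?ltW //; apply/eqP.
  rewrite (law_of_cosines A) (eucl_distC A C) distCA distAB dotE cE abE.
  have -> : (P ^+ 2 + 1) * X = P ^+ 2 - 1 by rewrite mulrC divfK.
  have -> : P ^+ 2 = a * b - 1 by rewrite abE addrK.
  by ring.
have detE : \det (edges A B C) = P *+ 2.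
  rewrite det_edgesE !mxE /=.
  transitivity (a * b * S); first by ring.
  by rewrite abE /S mulrC divfK.
have areaE : triangle_area A B C = P.
  rewrite /triangle_area detE ger0_norm ?mulrn_wge0 ?ltW //.
  by rewrite -[P *+ 2]mulr_natr mulfK ?pnatr_eq0.
exists A, B, C; split=> //.
  split; rewrite ?distAB ?distBC ?distCA ?areaE //; last exact: rational_natr.
  by rewrite nondegenerateE detE lt0r_neq0 ?mulrn_wgt0.
pose h := atan (1 / P).
have tanh : tan h = 1 / P by exact: atanK.
have h_gt0 : 0 < h by rewrite /h -(@atan0 R) lt_atan // divr_gt0.
have -> : angle C A B = h *+ 2.
  rewrite /angle dotE -/(eucl_dist A C) -/(eucl_dist A B) distAB eucl_distC distCA.
  rewrite mulrAC divff ?mul1r ?mulf_neq0 ?lt0r_neq0 //.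
  rewrite /X -(cos_double_of_tan (lt0r_neq0 P0) tanh) cosK //.
  have := atan_ltpi2 (1 / P); rewrite -/h => ?.
  by rewrite in_itv /=; apply/andP; split; rewrite mulr2n; lra.
by rewrite -[h *+ 2]mulr_natr mulfK ?pnatr_eq0.
Qed.

(** The sides invert [s = x/y], [a - b = s - 1/s], [a + b = z/(xy)]; both are
    positive because [z^2 - (x^2 - y^2)^2 = 4 (p^2 + 1) (xy)^2]. *)
Lemma triangle_of_solution (R : realType) (p : nat) : (0 < p)%N ->
  has_coprime_solution p ->
  exists A B C : 'rV[R]_2, [/\ heron_triangle A B C,
     triangle_area A B C = p%:R & tan (angle C A B / 2) = 1 / p%:R].
Proof.
move=> p0 [x [y [z [x0 y0 z0 _ sxy]]]].
set X : R := x%:R; set Y : R := y%:R; set Z : R := z%:R; set P : R := p%:R.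
have [X0 Y0 Z0 P0] : [/\ 0 < X, 0 < Y, 0 < Z & 0 < P] by rewrite !ltr0n.
have ZE : Z ^+ 2 = (X ^+ 2 + Y ^+ 2) ^+ 2 + (2 * P * X * Y) ^+ 2.
  have := congr1 (fun n => n%:R : R) sxy.
  by rewrite !(natrX, natrD, natrM).
have ltZ : (X ^+ 2 - Y ^+ 2) ^+ 2 < Z ^+ 2.
  rewrite ZE -subr_gt0.
  have -> : (X ^+ 2 + Y ^+ 2) ^+ 2 + (2 * P * X * Y) ^+ 2 - (X ^+ 2 - Y ^+ 2) ^+ 2
    = 4 * (P ^+ 2 + 1) * (X * Y) ^+ 2 by ring.
  rewrite mulr_gt0 ?exprn_gt0 ?mulr_gt0 //.
  by rewrite ltr_wpDl ?sqr_ge0.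
have [lt1 lt2] : 0 < Z + (X ^+ 2 - Y ^+ 2) /\ 0 < Z - (X ^+ 2 - Y ^+ 2).
  by split; nra.
have XY0 : 0 < 2 * X * Y by rewrite !mulr_gt0.
pose a := (Z + (X ^+ 2 - Y ^+ 2)) / (2 * X * Y).
pose b := (Z - (X ^+ 2 - Y ^+ 2)) / (2 * X * Y).
pose c := (X ^+ 2 + Y ^+ 2) / (X * Y).
apply: (@heron_triangle_of_sides R p a b c p0).
- exact: divr_gt0.
- exact: divr_gt0.
- by rewrite divr_gt0 ?mulr_gt0 // addr_gt0 ?exprn_gt0.
- exists ((z%:R + (x%:R ^+ 2 - y%:R ^+ 2)) / (2 * x%:R * y%:R)) => //.
  by rewrite fmorph_div !(rmorph_nat, rmorphXn, rmorphM, rmorphB, rmorphD).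
- exists ((z%:R - (x%:R ^+ 2 - y%:R ^+ 2)) / (2 * x%:R * y%:R)) => //.
  by rewrite fmorph_div !(rmorph_nat, rmorphXn, rmorphM, rmorphB, rmorphD).
- exists ((x%:R ^+ 2 + y%:R ^+ 2) / (x%:R * y%:R)) => //.
  by rewrite fmorph_div !(rmorph_nat, rmorphXn, rmorphM, rmorphB, rmorphD).
- transitivity ((Z ^+ 2 - (X ^+ 2 - Y ^+ 2) ^+ 2) / (2 * X * Y) ^+ 2).
    by rewrite /a /b; field; rewrite !pnatr_eq0 -!lt0n x0 y0.
  by rewrite ZE; field; rewrite !pnatr_eq0 -!lt0n x0 y0.
- by rewrite /a /b /c; field; rewrite !pnatr_eq0 -!lt0n x0 y0.
Qed.

Theorem theorem3p1 (R : realType) (p : nat) (p_prime : prime p) (p_odd : odd p) :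
  (has_coprime_solution p <->
     exists A B C : 'rV[R]_2,
       [/\ heron_triangle A B C,
           triangle_area A B C = p%:R
         & exists theta : R,
             is_angle_of A B C theta /\ tan (theta / 2) = 1 / p%:R])
  /\ ((p = 5 %[mod 8])%N ->
      (exists q : nat, prime q /\ (p ^ 2 + 1 = 2 * q)%N) ->
      ~ has_coprime_solution p).
Proof.
have p0 := prime_gt0 p_prime; split; first split.
- case/(triangle_of_solution R p0) => A [B [C [hABC areaE tanE]]].
  exists A, B, C; split=> //; exists (angle C A B); split=> //.
  by constructor 1.
- case=> A [B [C [hABC areaE [theta [anglE tanE]]]]].
  have hBCA := heron_rot hABC; have hCAB := heron_rot hBCA.
  case: anglE => thetaE; rewrite thetaE in tanE.
  + exact: solution_of_triangle tanE.
  + by apply: solution_of_triangle p0 hBCA _ tanE; rewrite (area_rot A B C).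
  + by apply: solution_of_triangle p0 hCAB _ tanE;
      rewrite (area_rot B C A) (area_rot A B C).
- move=> p8 [q [q_prime pq]] [x [y [z [x0 y0 _ cxy sxy]]]].
  exact: no_solution p_prime p8 q_prime pq x0 y0 cxy sxy.
Qed.
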